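(* Let $B=(0,0,1)$, and for $\theta>0$ let $\phi=\phi(\theta)=2\tan^{-1}(e^\theta)-\frac{\pi}{2}$ and $P=(\cos\theta\sin\phi,\sin\theta\sin\phi,\cos\phi)$, a point of the unit sphere $x^2+y^2+z^2=1$. If a small circle of the unit sphere passes through the point $B$ and is tangent at the point $P$ to the curve traced by $P$ as $\theta$ varies, then its spherical radius $R$ satisfies $$\tan^2R=\frac14\sec^4\left(\tfrac12\widehat{BP}\right).$$
   Context: For points $X,Y$ on the unit sphere with center $O$, $\widehat{XY}=\angle XOY$ denotes the spherical distance between $X$ and $Y$. The spherical radius $R\in(0,\frac{\pi}{2})$ of a small circle is the spherical distance from its (nearer) spherical center to any of its points. The curve traced by $P$ is the spherical interception curve. *)

(* Defs.v *)
From Stdlib Require Import Reals.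
From Coquelicot Require Import Coquelicot.
Open Scope R_scope.

Definition E3 : NormedModule R_AbsRing :=
  prod_NormedModule R_AbsRing
    (prod_NormedModule R_AbsRing R_NormedModule R_NormedModule) R_NormedModule.

Definition dot (u v : R * R * R) : R :=
  let '(u1, u2, u3) := u in
  let '(v1, v2, v3) := v in
  u1 * v1 + u2 * v2 + u3 * v3.

Definition enorm (u : R * R * R) : R := sqrt (dot u u).

Definition on_sphere (X : R * R * R) : Prop :=
  let '(x, y, z) := X in x ^ 2 + y ^ 2 + z ^ 2 = 1.

(* The angle XOY at the origin O. *)
Definition sphdist (X Y : R * R * R) : R :=
  acos (dot X Y / (enorm X * enorm Y)).

(* The plane n . X = d lies at distance |d| / |n| from O: it misses O and cuts
   the sphere in more than one point exactly when 0 < |d| < |n|. *)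
Definition small_circle (K : R * R * R -> Prop) : Prop :=
  exists (n : R * R * R) (d : R),
    0 < Rabs d < enorm n /\
    forall X : R * R * R, K X <-> on_sphere X /\ dot n X = d.

Definition spherical_center (K : R * R * R -> Prop) (A : R * R * R) : Prop :=
  on_sphere A /\
  forall X Y : R * R * R, K X -> K Y -> sphdist A X = sphdist A Y.

(* A small circle has two antipodal spherical centers. *)
Definition nearer_center (K : R * R * R -> Prop) (A : R * R * R) : Prop :=
  spherical_center K A /\
  forall A' X : R * R * R,
    spherical_center K A' -> K X -> sphdist A X <= sphdist A' X.

Definition spherical_radius (K : R * R * R -> Prop) (r : R) : Prop :=
  0 < r < PI / 2 /\
  exists A : R * R * R,
    nearer_center K A /\ forall X : R * R * R, K X -> sphdist A X = r.

(* v is the velocity at X of some curve lying in K near X. *)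
Definition tangent_vector (K : R * R * R -> Prop) (X v : R * R * R) : Prop :=
  exists c : R -> R * R * R,
    c 0 = X /\ locally 0 (fun t : R => K (c t)) /\
    is_derive (c : R -> E3) 0 v.

(* K passes through g t and its tangent line there is that of the curve g. *)
Definition tangent_to_curve_at
    (K : R * R * R -> Prop) (g : R -> R * R * R) (t : R) : Prop :=
  K (g t) /\
  exists v : R * R * R,
    is_derive (g : R -> E3) t v /\ v <> (0, 0, 0) /\ tangent_vector K (g t) v.

Definition sec (x : R) : R := / cos x.

Definition ptB : R * R * R := (0, 0, 1).

Definition phi (theta : R) : R := 2 * atan (exp theta) - PI / 2.

Definition ptP (theta : R) : R * R * R :=
  (cos theta * sin (phi theta), sin theta * sin (phi theta), cos (phi theta)).

(* Main.v *)
Require Import Defs.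
From Stdlib Require Import Reals.
From Coquelicot Require Import Coquelicot.
From Stdlib Require Import Lra Psatz.
Open Scope R_scope.

(** Everything is read off from the plane [dot n X = d] that cuts the small
    circle [K] out of the sphere.

    First, the radius: an elementary symmetry argument shows that any spherical
    center of [K] is parallel to [n], so that
    [cos r ^ 2 = d ^ 2 / dot n n] ([small_circle_cos_radius]).

    Next, the hypotheses on [K] are linear in [n]: passing through [B] and [P]
    gives [dot n B = d] and [dot n P = d], and tangency at [P] gives
    [dot n P' = 0], because a curve lying in the plane has its velocity
    orthogonal to [n] ([tangent_vector_orthogonal]).  The function [phi] is the
    Gudermannian: it satisfies [phi' = cos phi].  Hence, with [s = cos phi], the
    three linear equations determine [n] up to scale and give
    [dot n n = d ^ 2 * (1 + 1 / (1 + s) ^ 2)] ([tangent_plane_normal_sqr]).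

    Therefore [tan r ^ 2 = dot n n / d ^ 2 - 1 = 1 / (1 + s) ^ 2].  As the
    spherical distance from [B] to [P] has cosine [s], the half-angle formula
    [cos (x / 2) ^ 2 = (1 + cos x) / 2] turns the right-hand side into the same
    quantity. *)

(** * Inner products and spherical distance *)

Lemma dot_self_nonneg (u : R * R * R) : 0 <= dot u u.
Proof. destruct u as [[u1 u2] u3]; simpl; nra. Qed.

Lemma dot_sym (u v : R * R * R) : dot u v = dot v u.
Proof. destruct u as [[u1 u2] u3], v as [[v1 v2] v3]; simpl; ring. Qed.

Definition lincomb (a : R) (u : R * R * R) (b : R) (v : R * R * R) : R * R * R :=
  let '(u1, u2, u3) := u in
  let '(v1, v2, v3) := v in
  (a * u1 + b * v1, a * u2 + b * v2, a * u3 + b * v3).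

Lemma dot_lincomb (x u v : R * R * R) (a b : R) :
  dot x (lincomb a u b v) = a * dot x u + b * dot x v.
Proof.
destruct x as [[x1 x2] x3], u as [[u1 u2] u3], v as [[v1 v2] v3]; simpl; ring.
Qed.

(** Lagrange's identity exhibits the defect as a sum of three squares. *)
Lemma cauchy_schwarz_dot (u v : R * R * R) :
  (dot u v) ^ 2 <= dot u u * dot v v.
Proof.
destruct u as [[u1 u2] u3], v as [[v1 v2] v3]; simpl.
pose proof (pow2_ge_0 (u1 * v2 - u2 * v1)).
pose proof (pow2_ge_0 (u1 * v3 - u3 * v1)).
pose proof (pow2_ge_0 (u2 * v3 - u3 * v2)).
nra.
Qed.

Lemma on_sphere_dot (X : R * R * R) : on_sphere X <-> dot X X = 1.
Proof.
destruct X as [[x y] z]; simpl; split; intros H; lra.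
Qed.

Lemma cos_sphdist (X Y : R * R * R) :
  on_sphere X -> on_sphere Y -> cos (sphdist X Y) = dot X Y.
Proof.
intros HX%on_sphere_dot HY%on_sphere_dot.
unfold sphdist, enorm; rewrite HX, HY, sqrt_1.
replace (dot X Y / (1 * 1)) with (dot X Y) by field.
pose proof (cauchy_schwarz_dot X Y) as H; rewrite HX, HY in H.
apply cos_acos; nra.
Qed.

(** * The radius of a plane section of the sphere *)

(** Let [w] be [dot n n] times the component of [A] orthogonal to [n].  If [w]
    were nonzero, the two points of the circle in the directions [w] and [- w]
    from the center of its plane would have different inner products with [A].
    So [w = 0], that is, [A] is parallel to [n]; comparing the norms and the
    inner products with a point of the circle gives the relation. *)
Lemma constant_dot_on_circle (n A B : R * R * R) (d k : R) :
  d ^ 2 < dot n n ->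
  on_sphere A ->
  (forall X, on_sphere X -> dot n X = d -> dot A X = k) ->
  on_sphere B -> dot n B = d ->
  dot n n * k ^ 2 = d ^ 2.
Proof.
intros Hd HA Hk HB HnB.
apply on_sphere_dot in HA.
pose proof (Hk B HB HnB) as HkB.
pose proof (cauchy_schwarz_dot A n) as HCS; rewrite HA in HCS.
set (N := dot n n) in *; set (p := dot A n) in *.
assert (HN : 0 < N) by nra.
set (w := lincomb N A (- p) n).
assert (Hnw : dot n w = 0).
{ unfold w; rewrite dot_lincomb, (dot_sym n A); fold N p; ring. }
assert (HAw : dot A w = N - p ^ 2).
{ unfold w; rewrite dot_lincomb, HA; fold p; ring. }
assert (Hww : dot w w = N * (N - p ^ 2)).
{ unfold w at 2; rewrite dot_lincomb, (dot_sym w A), (dot_sym w n), HAw, Hnw.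
  ring. }
assert (Hp : p ^ 2 = N).
{ destruct (Rle_lt_or_eq_dec (p ^ 2) N) as [Hlt|Heq]; [lra| |exact Heq].
  exfalso.
  (* The scale that puts [(d / N) n + m w] and [(d / N) n - m w] on the
     sphere. *)
  set (m := sqrt ((1 - d ^ 2 / N) / dot w w)).
  assert (HW : 0 < dot w w) by (rewrite Hww; apply Rmult_lt_0_compat; lra).
  assert (Hq : 0 < (1 - d ^ 2 / N) / dot w w).
  { apply Rdiv_lt_0_compat; [|exact HW].
    apply Rlt_0_minus, Rlt_div_l; lra. }
  assert (Hm0 : 0 < m) by (apply sqrt_lt_R0; exact Hq).
  assert (Hm : m ^ 2 * dot w w = 1 - d ^ 2 / N).
  { unfold m; rewrite pow2_sqrt by lra; field; split; lra. }
  assert (Hpt : forall e, e ^ 2 = m ^ 2 -> d / N * p + e * (N - p ^ 2) = k).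
  { intros e He.
    set (X := lincomb (d / N) n e w).
    assert (HnX : dot n X = d).
    { unfold X; rewrite dot_lincomb, Hnw; fold N; field; lra. }
    assert (HwX : dot w X = e * dot w w).
    { unfold X; rewrite dot_lincomb, (dot_sym w n), Hnw; ring. }
    rewrite <- (Hk X).
    - unfold X; rewrite dot_lincomb, HAw; reflexivity.
    - apply on_sphere_dot.
      unfold X at 2; rewrite dot_lincomb, (dot_sym X n), (dot_sym X w), HnX, HwX.
      transitivity (d ^ 2 / N + e ^ 2 * dot w w); [field; lra|].
      rewrite He, Hm; ring.
    - exact HnX. }
  pose proof (Hpt m eq_refl) as H1.
  pose proof (Hpt (- m) ltac:(ring)) as H2.
  nra. }
assert (HwB : dot B w = 0).
{ pose proof (cauchy_schwarz_dot B w) as H; rewrite Hww, Hp in H; nra. }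
unfold w in HwB.
rewrite dot_lincomb, (dot_sym B A), (dot_sym B n), HkB, HnB in HwB.
apply Rmult_eq_reg_l with N; [|lra].
transitivity ((N * k) ^ 2); [ring|].
replace (N * k) with (p * d) by lra.
rewrite <- Hp; ring.
Qed.

Lemma small_circle_cos_radius
    (K : R * R * R -> Prop) (n B : R * R * R) (d r : R) :
  0 < Rabs d < enorm n ->
  (forall X, K X <-> on_sphere X /\ dot n X = d) ->
  K B -> spherical_radius K r ->
  dot n n * (cos r) ^ 2 = d ^ 2.
Proof.
intros [Hd Hdn] HK HB [_ [A [[[HA _] _] HAr]]].
apply HK in HB; destruct HB as [HB HnB].
apply constant_dot_on_circle with A B; try assumption.
- assert (Hn : (enorm n) ^ 2 = dot n n)
    by (apply pow2_sqrt, dot_self_nonneg).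
  rewrite <- Hn, <- (pow2_abs d); nra.
- intros X HX HnX.
  rewrite <- (HAr X) by (apply HK; split; assumption).
  symmetry; apply cos_sphdist; assumption.
Qed.

(** * Tangency *)

Lemma is_derive_linear (U W : NormedModule R_AbsRing) (l : U -> W) (f : R -> U)
    (x : R) (v : U) :
  is_linear l -> is_derive f x v -> is_derive (fun t => l (f t)) x (l v).
Proof.
intros Hl Hf.
apply filterdiff_ext_lin with (fun y => l (scal y v)).
- apply (filterdiff_comp' f l x _ l Hf), filterdiff_linear, Hl.
- intros y; apply (linear_scal l Hl).
Qed.

(** The functional [dot n] is a combination of the coordinates, which are
    continuous linear maps on [E3]; so it commutes with differentiation. *)
Lemma is_derive_dot (n : R * R * R) (f : R -> R * R * R) (x : R) (v : R * R * R) :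
  is_derive (f : R -> E3) x v -> is_derive (fun t => dot n (f t)) x (dot n v).
Proof.
intros Hf.
set (E2 := prod_NormedModule R_AbsRing R_NormedModule R_NormedModule).
pose proof (is_derive_linear E3 E2 fst f x v is_linear_fst Hf) as H12.
pose proof (is_derive_linear E3 R_NormedModule snd f x v is_linear_snd Hf) as H3.
pose proof (is_derive_linear E2 R_NormedModule fst _ x _ is_linear_fst H12) as H1.
pose proof (is_derive_linear E2 R_NormedModule snd _ x _ is_linear_snd H12) as H2.
destruct n as [[n1 n2] n3], v as [[v1 v2] v3].
apply (is_derive_ext (fun t => n1 * fst (fst (f t)) + n2 * snd (fst (f t))
                               + n3 * snd (f t))).
- intros t; destruct (f t) as [[y1 y2] y3]; reflexivity.
- apply (is_derive_plus (K := R_AbsRing) (V := R_NormedModule)).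
  + apply (is_derive_plus (K := R_AbsRing) (V := R_NormedModule)).
    * apply is_derive_scal, H1.
    * apply is_derive_scal, H2.
  + apply is_derive_scal, H3.
Qed.

Lemma tangent_vector_orthogonal
    (K : R * R * R -> Prop) (n X v : R * R * R) (d : R) :
  (forall Y, K Y -> dot n Y = d) -> tangent_vector K X v -> dot n v = 0.
Proof.
intros HK [c [_ [Hloc Hc]]].
apply is_derive_dot with (n := n) in Hc.
rewrite <- (is_derive_unique _ _ _ Hc).
apply is_derive_unique.
apply (is_derive_ext_loc (fun _ => d)).
- revert Hloc; apply filter_imp; intros t Ht; symmetry; apply HK, Ht.
- apply (is_derive_const (K := R_AbsRing) (V := R_NormedModule)).
Qed.

(** * The interception curve *)

Lemma cos_phi (theta : R) :
  cos (phi theta) = 2 * exp theta / (1 + exp theta ^ 2).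
Proof.
unfold phi.
rewrite cos_minus, cos_PI2, sin_PI2, sin_2a, sin_atan, cos_atan.
assert (Hp : 0 < 1 + (exp theta)²) by (pose proof (Rle_0_sqr (exp theta)); lra).
pose proof (sqrt_lt_R0 _ Hp).
replace (exp theta ^ 2) with ((exp theta)²) by (unfold Rsqr; ring).
rewrite <- (sqrt_sqrt (1 + (exp theta)²)) at 3 by lra.
field; lra.
Qed.

Lemma phi_bounds (theta : R) : 0 < theta -> 0 < phi theta < PI / 2.
Proof.
intros Ht; unfold phi.
pose proof (atan_bound (exp theta)).
assert (atan 1 < atan (exp theta)).
{ apply atan_increasing; rewrite <- exp_0; apply exp_increasing, Ht. }
rewrite atan_1 in *; lra.
Qed.

(** With the initial value [phi 0 = 0], this differential equation characterises
    the Gudermannian function. *)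
Lemma is_derive_phi (theta : R) : is_derive phi theta (cos (phi theta)).
Proof.
rewrite cos_phi; unfold phi.
auto_derive; [exact I|].
pose proof (exp_pos theta).
field; nra.
Qed.

Lemma on_sphere_ptP (theta : R) : on_sphere (ptP theta).
Proof.
simpl.
pose proof (sin2_cos2 theta) as H1; pose proof (sin2_cos2 (phi theta)) as H2.
unfold Rsqr in *; nra.
Qed.

Lemma is_derive_dot_ptP (n1 n2 n3 theta : R) :
  is_derive (fun t => dot (n1, n2, n3) (ptP t)) theta
    ((n2 * cos theta - n1 * sin theta) * sin (phi theta)
     + (n1 * cos theta + n2 * sin theta) * cos (phi theta) ^ 2
     - n3 * (cos (phi theta) * sin (phi theta))).
Proof.
pose proof (is_derive_phi theta) as Hphi.
simpl.
auto_derive.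
- repeat split; exists (cos (phi theta)); exact Hphi.
- replace (Derive (fun x => phi x) theta) with (cos (phi theta))
    by (symmetry; apply is_derive_unique, Hphi).
  ring.
Qed.

(** In the horizontal frame that turns with [theta], write [u] and [w] for the
    radial and tangential components of [n], and [s], [t] for the cosine and
    sine of [phi].  The equations become [n3 = d], [u t = d (1 - s)] and
    [w t + u s ^ 2 = d s t], whose solution is [u = d (1 - s) / t],
    [w = d s / (1 + s)]. *)
Lemma tangent_plane_normal_sqr (n : R * R * R) (d theta : R) :
  0 < theta ->
  dot n ptB = d -> dot n (ptP theta) = d ->
  is_derive (fun t => dot n (ptP t)) theta 0 ->
  dot n n * (1 + cos (phi theta)) ^ 2 = d ^ 2 * ((1 + cos (phi theta)) ^ 2 + 1).
Proof.
intros Ht HB HP HD.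
destruct n as [[n1 n2] n3].
pose proof (is_derive_unique _ _ _ (is_derive_dot_ptP n1 n2 n3 theta)) as HD'.
apply is_derive_unique in HD.
apply (eq_trans (eq_sym HD')) in HD; clear HD'.
simpl in HB, HP.
replace n3 with d in * by lra; clear HB.
destruct (phi_bounds theta Ht) as [Hphi0 Hphi1].
pose proof PI_RGT_0.
assert (Hs : 0 < cos (phi theta)) by (apply cos_gt_0; lra).
assert (Ht0 : 0 < sin (phi theta)) by (apply sin_gt_0; lra).
pose proof (sin2_cos2 (phi theta)) as Hst; unfold Rsqr in Hst.
pose proof (sin2_cos2 theta) as Hcs; unfold Rsqr in Hcs.
set (s := cos (phi theta)) in *; set (t := sin (phi theta)) in *.
set (u := n1 * cos theta + n2 * sin theta) in *.
set (w := n2 * cos theta - n1 * sin theta) in *.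
assert (Hn : n1 ^ 2 + n2 ^ 2 = u ^ 2 + w ^ 2).
{ transitivity ((n1 ^ 2 + n2 ^ 2)
    * (sin theta * sin theta + cos theta * cos theta));
    [rewrite Hcs; ring | unfold u, w; ring]. }
assert (Hu : u * t = d * (1 - s)) by (unfold u; lra).
assert (Hu' : u * (1 + s) = d * t).
{ apply Rmult_eq_reg_r with t; [|lra].
  transitivity (u * t * (1 + s)); [ring|].
  rewrite Hu; transitivity (d * (1 - s * s)); [ring|].
  rewrite <- Hst; ring. }
assert (Hw : w * (1 + s) = d * s).
{ apply Rmult_eq_reg_r with t; [|lra].
  transitivity ((d * (s * t) - u * s ^ 2) * (1 + s)).
  - replace (d * (s * t)) with (w * t + u * s ^ 2) by lra; ring.
  - transitivity (d * s * t * (1 + s) - u * (1 + s) * s ^ 2); [ring|].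
    rewrite Hu'; ring. }
transitivity ((n1 ^ 2 + n2 ^ 2 + d ^ 2) * (1 + s) ^ 2); [simpl; ring|].
rewrite Hn.
transitivity ((u * (1 + s)) ^ 2 + (w * (1 + s)) ^ 2 + d ^ 2 * (1 + s) ^ 2);
  [ring|].
rewrite Hu', Hw.
transitivity (d ^ 2 * (t * t + s * s) + d ^ 2 * (1 + s) ^ 2); [ring|].
rewrite Hst; ring.
Qed.

(** * The radius formula *)

Theorem theorem6 (theta : R) (Htheta : 0 < theta)
    (K : R * R * R -> Prop) (HK : small_circle K)
    (HB : K ptB) (HP : tangent_to_curve_at K ptP theta)
    (r : R) (Hr : spherical_radius K r) :
  (tan r) ^ 2 = 1 / 4 * (sec (1 / 2 * sphdist ptB (ptP theta))) ^ 4.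
Proof.
destruct HK as [n [d [Hd HK]]].
destruct HP as [HKP [v [Hv [_ Htan]]]].
pose proof (small_circle_cos_radius K n ptB d r Hd HK HB Hr) as Hcos.
assert (Hplane : forall X, K X -> dot n X = d) by (intros X HX; apply HK, HX).
assert (HD : is_derive (fun t => dot n (ptP t)) theta 0).
{ rewrite <- (tangent_vector_orthogonal K n _ v d Hplane Htan).
  apply is_derive_dot, Hv. }
pose proof (tangent_plane_normal_sqr n d theta Htheta (Hplane _ HB)
              (Hplane _ HKP) HD) as Hnn.
set (s := cos (phi theta)) in *.
destruct (phi_bounds theta Htheta) as [Hphi0 Hphi1].
assert (Hs : 0 < s) by (apply cos_gt_0; lra).
destruct Hr as [[Hr0 Hr1] _].
assert (Hc : 0 < cos r) by (apply cos_gt_0; lra).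
assert (Hd2 : 0 < d ^ 2) by (rewrite <- (pow2_abs d); destruct Hd; nra).
set (x := sphdist ptB (ptP theta)).
assert (Hx : cos x = s).
{ unfold x; rewrite cos_sphdist; [simpl; fold s; ring | simpl; ring |].
  apply on_sphere_ptP. }
assert (Hhalf : (cos (1 / 2 * x)) ^ 2 = (1 + s) / 2).
{ rewrite <- Hx; replace x with (2 * (1 / 2 * x)) at 2 by field.
  rewrite cos_2a_cos; field. }
assert (Hcr : (cos r) ^ 2 * ((1 + s) ^ 2 + 1) = (1 + s) ^ 2).
{ apply Rmult_eq_reg_l with (d ^ 2); [|lra].
  transitivity ((d ^ 2 * ((1 + s) ^ 2 + 1)) * (cos r) ^ 2); [ring|].
  rewrite <- Hnn, <- Hcos; ring. }
pose proof (sin2_cos2 r) as Hsc; unfold Rsqr in Hsc.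
transitivity (1 / (1 + s) ^ 2).
- unfold tan.
  transitivity ((1 - (cos r) ^ 2) / (cos r) ^ 2).
  + replace (1 - cos r ^ 2) with (sin r ^ 2) by (rewrite <- Hsc; ring).
    field; lra.
  + apply Rmult_eq_reg_r with ((cos r) ^ 2 * (1 + s) ^ 2); [|nra].
    field_simplify; [|nra|nra].
    nra.
- unfold sec; rewrite pow_inv.
  replace (cos (1 / 2 * x) ^ 4) with ((cos (1 / 2 * x) ^ 2) ^ 2) by ring.
  rewrite Hhalf; field; lra.
Qed.
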